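(* Let $\mathcal L$ be a finite relational language, let $(G_n)_{n\in\mathbb N}$ be a sequence of finite $\mathcal L$-structures and let $U$ be a non-principal ultrafilter on $\mathbb N$. Then there exists a measure $\nu$ on the ultraproduct $\widetilde G=\prod_U G_n$ such that for every first-order formula $\phi$ with $p$ free variables $$\int_{\widetilde G}\cdots\int_{\widetilde G}\mathbf 1_\phi([x_1],\dots,[x_p])\,\mathrm d\nu([x_1])\cdots\mathrm d\nu([x_p])=\lim_U\langle\phi,G_i\rangle .$$ Moreover, the iterated integral $\int_{\widetilde G}\cdots\int_{\widetilde G}\mathbf 1_\phi([x_1],\dots,[x_p])\,\mathrm d\nu([x_1])\cdots\mathrm d\nu([x_p])$ is invariant under any permutation of the order of the integrations: for every permutation $\sigma$ of $\{1,\dots,p\}$, $$\lim_U\langle\phi,G_i\rangle=\int_{\widetilde G}\cdots\int_{\widetilde G}\mathbf 1_\phi([x_1],\dots,[x_p])\,\mathrm d\nu([x_{\sigma(1)}])\cdots\mathrm d\nu([x_{\sigma(p)}]).$$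
   Context: Structures are nonempty. For a formula $\phi(x_1,\dots,x_p)$ and a finite $\mathcal L$-structure $G$, $\langle\phi,G\rangle=|\{(v_1,\dots,v_p)\in G^p: G\models\phi(v_1,\dots,v_p)\}|/|G|^p$. The ultraproduct $\prod_U G_n$ is the quotient of $\prod_n G_n$ by the relation $(x_n)\sim(y_n)\iff\{n:x_n=y_n\}\in U$, with each $p$-ary relation symbol $R$ interpreted by $([v^1],\dots,[v^p])\in R\iff\{n:(v^1_n,\dots,v^p_n)\in R^{G_n}\}\in U$; $[x]$ denotes the class of $x$. $\lim_U a_n$ denotes the ultralimit of a bounded real sequence along $U$. $\mathbf 1_\phi([x_1],\dots,[x_p])$ equals $1$ if $\widetilde G\models\phi([x_1],\dots,[x_p])$ and $0$ otherwise. ''Measure'' means a countably additive measure on some $\sigma$-algebra of subsets of $\widetilde G$; the multiple integrals are iterated integrals, integrating one variable at a time in the indicated order (the claim includes that the function to be integrated at each stage is measurable). *)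

(* Defs.v *)
From HB Require Import structures.
From mathcomp Require Import all_boot all_order all_algebra perm.
From mathcomp Require Import generic_quotient.
From mathcomp Require Import all_classical all_reals all_analysis.
From mathcomp Require Import measurable_realfun.

Set Implicit Arguments.
Unset Strict Implicit.
Unset Printing Implicit Defensive.

Import Order.TTheory GRing.Theory Num.Theory.
Import numFieldNormedType.Exports.

Local Open Scope classical_set_scope.
Local Open Scope ring_scope.

Record language := Language { symbol :> finType; arity : symbol -> nat }.

(* Well-scoped syntax: the free variables of [phi : formula L p] are among
   x_0, ..., x_(p-1), indexed by 'I_p.  A quantifier binds the variable 0 of
   its body and shifts the others, see [extend] and [sat]. *)
Inductive formula (L : language) : nat -> Type :=
| FFalse p : formula L p
| FEq p (i j : 'I_p) : formula L p
| FRel p (r : L) (t : (arity r).-tuple 'I_p) : formula L p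
| FNot p (phi : formula L p) : formula L p
| FAnd p (phi psi : formula L p) : formula L p
| FOr p (phi psi : formula L p) : formula L p
| FImp p (phi psi : formula L p) : formula L p
| FAll p (phi : formula L p.+1) : formula L p
| FEx p (phi : formula L p.+1) : formula L p.

Record structure (L : language) := Structure {
  carrier :> Type ;
  interp : forall r : L, set ((arity r).-tuple carrier) ;
  carrier_nonempty : inhabited carrier }.

Record fin_structure (L : language) := FinStructure {
  fin_carrier :> finType ;
  fin_interp : forall r : L, set ((arity r).-tuple fin_carrier) ;
  fin_carrier_nonempty : inhabited fin_carrier }.

Definition fin_point (L : language) (G : fin_structure L) : G :=
  projT1 (cid (let: inhabits x := fin_carrier_nonempty G in
               ex_intro (fun=> True) x I)).

Coercion structure_of_fin (L : language) (G : fin_structure L) : structure L :=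
  Structure (@fin_interp L G) (fin_carrier_nonempty G).

Definition extend (T : Type) (p : nat) (x : T) (v : 'I_p -> T) : 'I_p.+1 -> T :=
  fun i => if unlift ord0 i is Some j then v j else x.

Fixpoint sat (L : language) (M : structure L) (p : nat) (phi : formula L p) :
    ('I_p -> M) -> Prop :=
  match phi in formula _ p return ('I_p -> M) -> Prop with
  | FFalse _ => fun _ => False
  | FEq _ i j => fun v => v i = v j
  | FRel _ r t => fun v => interp (map_tuple v t)
  | FNot _ phi => fun v => ~ sat phi v
  | FAnd _ phi psi => fun v => sat phi v /\ sat psi v
  | FOr _ phi psi => fun v => sat phi v \/ sat psi v
  | FImp _ phi psi => fun v => sat phi v -> sat psi v
  | FAll _ phi => fun v => forall x, sat phi (extend x v)
  | FEx _ phi => fun v => exists x, sat phi (extend x v)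
  end.

Definition stone_pairing (R : realType) (L : language) (p : nat)
    (phi : formula L p) (G : fin_structure L) : R :=
  #|[pred v : {ffun 'I_p -> G} | `[< sat (M := G) phi v >]]|%:R / #|G|%:R ^+ p.

Section ultraproduct.
Context {L : language} (G : nat -> fin_structure L).
Context (U : set_system nat) {FU : Filter U}.

Definition ultra_eq : rel (forall n, G n) :=
  fun x y => `[< U [set n | x n = y n] >].

Lemma ultra_eq_is_equiv : equiv_class_of ultra_eq.
Proof.
split=> [x|x y|y x z].
- by apply/asboolP; apply: (filterS _ filterT).
- by apply: asbool_equiv_eq; split; apply: filterS => n /= ->.
- move=> /asboolP xy /asboolP yz; apply/asboolP.
  by apply: filterS2 xy yz => n /= -> ->.
Qed.

Canonical ultra_eq_equiv := EquivRelPack ultra_eq_is_equiv.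

Definition ultra_carrier := {eq_quot ultra_eq}%qT.

HB.instance Definition _ := Choice.on ultra_carrier.
HB.instance Definition _ := EqQuotient.on ultra_carrier.
HB.instance Definition _ := isPointed.Build ultra_carrier
  (\pi%qT (fun n => fin_point (G n))).

Definition ultra_class (x : forall n, G n) : ultra_carrier := \pi%qT x.

Lemma ultra_classP (x y : forall n, G n) :
  ultra_class x = ultra_class y <-> U [set n | x n = y n].
Proof.
by split=> [/eqmodP/asboolP //|xy]; apply/eqmodP/asboolP.
Qed.

(* Stated on canonical representatives; [ultra_interpP] gives the
   characterization on arbitrary ones. *)
Definition ultra_interp (r : L) : set ((arity r).-tuple ultra_carrier) :=
  [set t | U [set n | fin_interp (map_tuple (fun x => repr x n) t)]].

Lemma ultra_interpP (r : L) (t : (arity r).-tuple (forall n, G n)) :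
  ultra_interp (map_tuple ultra_class t) <->
  U [set n | fin_interp (map_tuple (fun x => x n) t)].
Proof.
have same : U [set n | map_tuple (fun x => repr x n) (map_tuple ultra_class t)
                       = map_tuple (fun x => x n) t].
  have H i : U [set n | repr (ultra_class (tnth t i)) n = tnth t i n].
    by apply/ultra_classP; rewrite /ultra_class reprK.
  have := filter_forall FU H.
  by apply: filterS => n E; apply/eq_from_tnth => i; rewrite !tnth_map; exact: E.
by split=> h; apply: filterS2 same h => n /= ->.
Qed.

Definition ultraproduct : structure L :=
  Structure ultra_interp (inhabits (point : ultra_carrier)).

End ultraproduct.

Arguments ultra_carrier {L} G U {FU}.
Arguments ultra_class {L} G U {FU} x.
Arguments ultraproduct {L} G U {FU}.

Section iterated_integral.
Context {d : measure_display} {T : measurableType d} {R : realType}.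
Context (nu : {measure set T -> \bar R}) {p : nat}.

Definition update (v : 'I_p -> T) (i : 'I_p) (x : T) : 'I_p -> T :=
  fun j => if j == i then x else v j.

Definition integrate_var (i : 'I_p) (f : ('I_p -> T) -> \bar R)
    (v : 'I_p -> T) : \bar R :=
  (\int[nu]_x f (update v i x))%E.

(* [s] lists the variables in the order of integration, innermost integral
   first.  When [s] enumerates all the variables, the result does not depend
   on the valuation at which it is evaluated. *)
Fixpoint iterated_integral (s : seq 'I_p) (f : ('I_p -> T) -> \bar R) :
    ('I_p -> T) -> \bar R :=
  if s is i :: s' then iterated_integral s' (integrate_var i f) else f.

(* At each stage the integrand is measurable in the variable of integration,
   for all values of the others. *)
Fixpoint iterated_measurable (s : seq 'I_p) (f : ('I_p -> T) -> \bar R) : Prop :=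
  if s is i :: s' then
    (forall v, measurable_fun [set: T] (fun x => f (update v i x))) /\
    iterated_measurable s' (integrate_var i f)
  else True.

End iterated_integral.

Definition formula_indic (R : realType) (L : language) (M : structure L)
    (p : nat) (phi : formula L p) (v : 'I_p -> M) : \bar R :=
  (\1_[set w | sat phi w] v)%:E.

(* Main.v *)
(* Loeb's construction.  The classes of sequences lying coordinatewise in given
   sets A_n of G_n form an algebra of "internal" sets, on which the ultralimit
   of the normalized counting measures is a content.  As U is non-principal,
   internal sets are countably saturated: an internal set that is a countable
   union of internal sets is the union of finitely many of them.  Hence the
   content is sigma-additive and Caratheodory's theorem extends it to the
   generated sigma-algebra.  Counting the levels j <= k h_n shows that an
   ultralimit of functions h_n : G_n -> [0, 1] of one variable is measurable and
   that its integral is the ultralimit of the means of h_n.  By Los's theorem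
   the indicator of phi is an ultralimit of functions on G_n, and integrating
   a variable keeps this form, replacing these functions by their means over
   that variable; after all variables, in any order, the Stone pairings
   remain. *)
From HB Require Import structures.
Require Import Defs.
From mathcomp Require Import all_boot all_order all_algebra perm.
From mathcomp Require Import all_classical all_reals all_analysis.
From mathcomp Require Import measurable_realfun.
From mathcomp Require Import lra.

Set Implicit Arguments.
Unset Strict Implicit.
Unset Printing Implicit Defensive.

Import Order.TTheory GRing.Theory Num.Theory.
Import numFieldNormedType.Exports.
Local Open Scope classical_set_scope.
Local Open Scope ring_scope.

(** * Means over finite types and over valuations *)

Section mean.
Context {R : realType}.

Definition mean (T : finType) (f : T -> R) : R := (\sum_x f x) / #|T|%:R.

Definition fupdate (T : Type) (p : nat) (v : 'I_p -> T) (i : 'I_p) (x : T) :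
    'I_p -> T :=
  fun j => if j == i then x else v j.

Section finite_type.
Context {T : finType} (t0 : inhabited T).

Lemma inhabited_card_gt0 : (0 : R) < #|T|%:R.
Proof. by rewrite ltr0n; case: t0 => x; apply/card_gt0P; exists x. Qed.

Lemma mean_cst (a : R) : mean (fun _ : T => a) = a.
Proof.
by rewrite /mean sumr_const -[a *+ _]mulr_natr mulfK// gt_eqF// inhabited_card_gt0.
Qed.

Lemma le_mean (f g : T -> R) : (forall x, f x <= g x) -> mean f <= mean g.
Proof.
by move=> fg; rewrite ler_pM2r ?invr_gt0 ?inhabited_card_gt0// ler_sum.
Qed.

Lemma mean01 (f : T -> R) :
  (forall x, 0 <= f x <= 1) -> 0 <= mean f <= 1.
Proof.
move=> f01; rewrite -{1}(mean_cst 0) -[X in _ && (_ <= X)](mean_cst 1).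
by rewrite !le_mean// => x; case/andP: (f01 x).
Qed.

End finite_type.

Lemma meanD (T : finType) (f g : T -> R) :
  mean (fun x => f x + g x) = mean f + mean g.
Proof. by rewrite /mean big_split mulrDl. Qed.

Lemma meanZ (T : finType) (a : R) (f : T -> R) :
  mean (fun x => a * f x) = a * mean f.
Proof. by rewrite /mean -mulr_sumr mulrA. Qed.

Lemma mean_sum (T : finType) (k : nat) (f : 'I_k -> T -> R) :
  mean (fun x => \sum_j f j x) = \sum_j mean (f j).
Proof. by rewrite /mean exchange_big mulr_suml. Qed.

Section iterated_mean.
Context {T : finType} (t0 : inhabited T) {p : nat}.
Implicit Types (f : ('I_p -> T) -> R) (s A : seq 'I_p).

Definition mean_var (i : 'I_p) f (v : 'I_p -> T) : R :=
  mean (fun x => f (fupdate v i x)).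

Fixpoint iterated_mean s f : ('I_p -> T) -> R :=
  if s is i :: s' then iterated_mean s' (mean_var i f) else f.

(* The map (w, x) |-> (w with w_i := x, w_i) is an involution. *)
Lemma mean_mean_var (i : 'I_p) f :
  mean (fun w : {ffun 'I_p -> T} => mean_var i f w) =
  mean (fun w : {ffun 'I_p -> T} => f w).
Proof.
rewrite /mean_var {2}/mean /mean -mulr_suml pair_big/=.
pose swap (wx : {ffun 'I_p -> T} * T) :=
  ([ffun j => fupdate wx.1 i wx.2 j], wx.1 i).
have swapK : involutive swap.
  move=> [w x]; rewrite /swap/=.
  congr (_, _); last by rewrite ffunE /fupdate eqxx.
  by apply/ffunP => j; rewrite !ffunE /fupdate ffunE /fupdate; case: eqP => [->|].
rewrite (reindex_inj (inv_inj swapK))/=.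
have -> : \sum_wx f (fupdate (swap wx).1 i (swap wx).2) =
    \sum_(wx : {ffun 'I_p -> T} * T) f wx.1.
  apply: eq_bigr => -[w x] _; congr (f _); apply/funext => j.
  by rewrite /swap /fupdate/= ffunE; case: eqP => [->|].
rewrite -(pair_big xpredT xpredT (fun (w : {ffun 'I_p -> T}) _ => f w))/=.
under eq_bigr do rewrite sumr_const -[f _ *+ _]mulr_natr.
by rewrite -mulr_suml mulfK// gt_eqF// inhabited_card_gt0.
Qed.

Lemma mean_iterated_mean s f :
  mean (fun w : {ffun 'I_p -> T} => iterated_mean s f w) =
  mean (fun w : {ffun 'I_p -> T} => f w).
Proof. by elim: s f => //= i s IH f; rewrite IH mean_mean_var. Qed.

Definition independent_of A f := forall v w : 'I_p -> T,
  (forall j, j \notin A -> v j = w j) -> f v = f w.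

(** Averaging over [i] removes the dependence on [i]; [catrev] follows the recursion, which moves
    each averaged variable from [s] onto [A]. *)
Lemma iterated_mean_independent A s f : independent_of A f ->
  independent_of (catrev s A) (iterated_mean s f).
Proof.
elim: s A f => //= i s IH A f fA; apply: IH => v w vw.
congr mean; apply/funext => x; apply: fA => j jA; rewrite /fupdate.
by case: eqP => // /eqP ji; apply: vw; rewrite inE negb_or ji.
Qed.

(** Once every variable is averaged out, the function is constant, hence equal to its own mean over
    all valuations; by [mean_iterated_mean] that mean is the one of [f]. *)
Lemma iterated_mean_all s f v : (forall i, i \in s) ->
  iterated_mean s f v = mean (fun w : {ffun 'I_p -> T} => f w).
Proof.
move=> alls; rewrite -(mean_iterated_mean s).
have w0 : inhabited {ffun 'I_p -> T} by case: t0 => x; exists; exact: [ffun=> x].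
rewrite -[LHS](mean_cst w0); congr mean; apply/funext => w.
apply: (@iterated_mean_independent [::]) => [v' w' vw'|j].
  by congr f; apply/funext => j; exact: vw'.
by rewrite catrevE mem_cat mem_rev alls.
Qed.

End iterated_mean.

End mean.

Lemma stone_pairingE (R : realType) (L : language) (p : nat)
    (phi : formula L p) (G : fin_structure L) :
  stone_pairing R phi G =
  mean (fun w : {ffun 'I_p -> G} =>
    \1_[set v | sat (M := G) phi v] (w : 'I_p -> G)).
Proof.
rewrite /stone_pairing /mean card_ffun card_ord natrX; congr (_ / _).
rewrite -sum1_card natr_sum big_mkcond/=; apply: eq_bigr => w _.
rewrite inE /indic; case: asboolP => h.
  by rewrite mem_set.
by rewrite memNset.
Qed.

(** * Counting layers below a real number *)

Section layers.
Context {R : realType}.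

(** The sum counts the integers from 1 to [k] that are at most [z]: it is the smaller of [k] and the
    floor of [z]. *)
Lemma sum_layers_le (z : R) (k : nat) : 0 <= z ->
  \sum_(j < k) (j.+1%:R <= z)%R%:R <= z.
Proof.
move=> z0; elim: k => [|k IH]; first by rewrite big_ord0.
have [kz|kz] := leP (k.+1%:R : R) z; last first.
  by rewrite big_ord_recr/= (lt_geF kz) addr0.
apply: le_trans kz; rewrite -[X in _ <= X%:R]card_ord -sum1_card natr_sum.
by apply: ler_sum => j _; case: (_ <= z).
Qed.

Lemma le_sum_layers (z : R) (k : nat) : z <= k%:R ->
  z <= \sum_(j < k) (j.+1%:R <= z)%R%:R + 1.
Proof.
elim: k => [|k IH] zk; first by rewrite big_ord0 add0r (le_trans zk).
rewrite big_ord_recr/=; have [/IH|kz] := leP z k%:R.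
  by move=> /le_trans; apply; rewrite lerD2r lerDl ler0n.
(* Here [k < z <= k + 1], so the first [k] layers all count and contribute [k]. *)
apply: (le_trans zk); rewrite -natr1 lerD2r.
apply: (@le_trans _ _ (\sum_(j < k) (j.+1%:R <= z)%R%:R)); last first.
  by rewrite lerDl ler0n.
rewrite -[X in X%:R <= _]card_ord -sum1_card natr_sum.
apply: ler_sum => j _; rewrite (le_trans _ (ltW kz))// ler_nat.
exact: ltn_ord.
Qed.

End layers.

(** * Limits along an ultrafilter *)

Section ultralimit.
Context {R : realType} (U : set_system nat) {UU : UltraFilter U}.

Lemma ultra_dichotomy (A : set nat) : ~ U A -> U (~` A).
Proof. by have [] := in_ultra_setVsetC A UU. Qed.

Lemma nonprincipal_ge (m : nat) : (forall n, U <> principal_filter n) ->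
  U [set n | (m <= n)%N].
Proof.
move=> np; elim: m => [|m IH]; first exact: filterS filterT.
have : U (~` [set m]).
  apply: ultra_dichotomy => Um; apply: (np m); apply: esym.
  (* Every set of [U] meets the singleton of [m], so [U] is contained in the principal filter at [m]
     and equals it by maximality. *)
  have [_ maxU] := UU; apply: maxU; first exact: principal_filter_proper.
  move=> A UA; apply/principal_filterP.
  by have [n [An <-]] := filter_ex (filterI UA Um).
apply: filterS2 IH => n /= mn nm.
by rewrite ltn_neqAle mn andbT; apply/eqP => /esym.
Qed.

Definition ulim (a : nat -> R) : R := lim (a n @[n --> U]).

(** The image of [U] under [a] is an ultrafilter containing the compact segment [0, 1], so it
    converges. *)
Lemma cvg_ulim (a : nat -> R) : (forall n, 0 <= a n <= 1) ->
  a n @[n --> U] --> ulim a.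
Proof.
move=> a01; have aU : UltraFilter (a n @[n --> U]).
  split=> [|F PF sub]; first exact: fmap_proper_filter.
  apply/seteqP; split; last exact: sub.
  move=> A FA; apply: contrapT => /ultra_dichotomy UA.
  by have [x []] := filter_ex (filterI FA (sub (~` A) UA)).
have := @segment_compact R 0 1; rewrite compact_ultra => /(_ _ aU)[|l [_ al]].
  by apply: nearW => n; rewrite /= in_itv/=.
by apply/cvg_ex; exists l.
Qed.

Lemma ulim_eq (a : nat -> R) (l : R) : a n @[n --> U] --> l -> ulim a = l.
Proof. exact: cvg_lim. Qed.

Lemma eq_ulim (a b : nat -> R) : (forall n, 0 <= a n <= 1) ->
  U [set n | a n = b n] -> ulim a = ulim b.
Proof.
move=> a01 ab; apply: esym; apply: ulim_eq.
apply: cvg_trans (cvg_ulim a01); apply: near_eq_cvg.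
exact: ab.
Qed.

Lemma ulim01 (a : nat -> R) : (forall n, 0 <= a n <= 1) -> 0 <= ulim a <= 1.
Proof.
move=> a01; have /cvgP ca := cvg_ulim a01; apply/andP; split.
  by apply: limr_ge => //; apply: nearW => n; case/andP: (a01 n).
by apply: limr_le => //; apply: nearW => n; case/andP: (a01 n).
Qed.

Lemma ulim_indic (T : nat -> Type) (A : forall n, set (T n)) (x : forall n, T n) :
  ulim (fun n => \1_(A n) (x n)) = (`[< U [set n | A n (x n)] >])%:R.
Proof.
apply: ulim_eq; apply: cvg_near_cst; case: asboolP => [|/ultra_dichotomy] UA.
  by apply: filterS UA => n /= An; rewrite indicE mem_set.
by apply: filterS UA => n /= An; rewrite indicE memNset.
Qed.

End ultralimit.

(** * Internal sets and countable saturation *)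

Section internal_sets.
Context {L : language} {G : nat -> fin_structure L}.
Context {U : set_system nat} {UU : UltraFilter U}.
Local Notation T := (ultra_carrier G U).

Definition internal (A : forall n, set (G n)) : set T :=
  [set X | U [set n | A n (repr X n)]].

Lemma repr_ultra_class (x : forall n, G n) :
  U [set n | repr (ultra_class G U x) n = x n].
Proof. by apply/ultra_classP; rewrite /ultra_class reprK. Qed.

Lemma internal_class (A : forall n, set (G n)) (x : forall n, G n) :
  internal A (ultra_class G U x) <-> U [set n | A n (x n)].
Proof.
by have Ux := repr_ultra_class x; split => h; apply: filterS2 Ux h => n /= ->.
Qed.

(** Were the inclusion to fail for U-almost all [n], points chosen in [A n] outside [B n] would form
    a class in the first internal set but not in the second. *)
Lemma internal_subset (A B : forall n, set (G n)) :
  internal A `<=` internal B -> U [set n | A n `<=` B n].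
Proof.
move=> AB; apply: contrapT => /ultra_dichotomy nAB.
have wit n : {x : G n | ~ A n `<=` B n -> A n x /\ ~ B n x}.
  apply: cid; have [|/existsNP[x /not_implyP ABx]] := pselect (A n `<=` B n).
    by exists (fin_point (G n)).
  by exists x.
pose x n := sval (wit n).
have xA : internal A (ultra_class G U x).
  by apply/internal_class; apply: filterS nAB => n /(svalP (wit n))[].
have /internal_class xB := AB _ xA.
by have [n [/(svalP (wit n))[_]]] := filter_ex (filterI nAB xB).
Qed.

Lemma internal_inj (A B : forall n, set (G n)) :
  internal A = internal B -> U [set n | A n = B n].
Proof.
move=> AB; have sAB : internal A `<=` internal B by rewrite AB.
have sBA : internal B `<=` internal A by rewrite AB.
apply: filterS2 (internal_subset sAB) (internal_subset sBA) => n /= ? ?.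
exact/seteqP.
Qed.

Lemma internal0 : internal (fun=> set0) = set0.
Proof. by apply/seteqP; split=> // X /filter_ex[]. Qed.

Lemma internalU (A B : forall n, set (G n)) :
  internal A `|` internal B = internal (fun n => A n `|` B n).
Proof.
apply/seteqP; split=> X /=.
  by case; apply: filterS => n /= ?; [left|right].
move=> UAB; have [?|/ultra_dichotomy nA] := pselect (internal A X); first by left.
by right; apply: filterS2 UAB nA => n /= [].
Qed.

Lemma internalC (A : forall n, set (G n)) :
  ~` internal A = internal (fun n => ~` A n).
Proof.
apply/seteqP; split=> X /=; first by move=> /ultra_dichotomy.
by move=> nA XA; have [n []] := filter_ex (filterI nA XA).
Qed.

Lemma internalI (A B : forall n, set (G n)) :
  internal A `&` internal B = internal (fun n => A n `&` B n).
Proof.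
rewrite -[LHS]setCK setCI !internalC internalU internalC; congr internal.
by apply: functional_extensionality_dep => n; rewrite setCU !setCK.
Qed.

Hypothesis nonprincipal : forall n : nat, U <> principal_filter n.

(** A diagonal argument: coordinate [n] satisfies the longest initial run of conditions, of index at
    most [n], that is jointly satisfiable in [G n]. *)
Lemma internal_saturation (A : nat -> forall n, set (G n)) :
  (forall k, exists X, forall i, (i <= k)%N -> internal (A i) X) ->
  exists X, forall i, internal (A i) X.
Proof.
move=> fip; pose P k n := exists x : G n, forall i, (i <= k)%N -> A i n x.
have UP k : U [set n | P k n].
  have [X XA] := fip k.
  have : U [set n | forall i : 'I_k.+1, A i n (repr X n)].
    by apply: filter_forall => i; apply: XA; rewrite -ltnS.
  apply: filterS => n /= Xn; exists (repr X n) => i ik.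
  exact: (Xn (Ordinal (ik : (i < k.+1)%N))).
(* A witness for the largest [k <= m] with [P k n] serves all smaller ones; [fin_point] is the
   default when there is none. *)
have best n m : exists x : G n,
    forall k, (k <= m)%N -> P k n -> forall i, (i <= k)%N -> A i n x.
  elim: m => [|m [x xP]].
    have [[x xA]|nP] := pselect (P 0%N n).
      by exists x => k; rewrite leqn0 => /eqP ->.
    by exists (fin_point (G n)) => k; rewrite leqn0 => /eqP ->.
  have [[y yA]|nP] := pselect (P m.+1 n).
    by exists y => k km _ i ik; apply: yA; exact: leq_trans km.
  exists x => k; rewrite leq_eqVlt => /predU1P[-> //|]; rewrite ltnS; exact: xP.
pose x n := sval (cid (best n n)).
exists (ultra_class G U x) => i; apply/internal_class.
(* Both [i <= n] and [P i n] hold U-almost everywhere, and then [x n] lies in [A i n]. *)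
apply: filterS2 (nonprincipal_ge i nonprincipal) (UP i) => n /= ni Pn.
exact: (svalP (cid (best n n))) ni Pn _ _.
Qed.

End internal_sets.

(** * The content on the algebra of internal sets *)

Section loeb_content.
Context {L : language} {G : nat -> fin_structure L}.
Context {U : set_system nat} {UU : UltraFilter U}.
Local Notation T := (ultra_carrier G U).

Definition internal_algebra : Type := T.
HB.instance Definition _ := Pointed.on internal_algebra.

Definition internal_sets : set (set internal_algebra) := range internal.

Lemma internal_sets0 : internal_sets set0.
Proof. by exists (fun=> set0) => //; exact: internal0. Qed.

Lemma internal_setsU : setU_closed internal_sets.
Proof.
by move=> _ _ [A _ <-] [B _ <-]; eexists => //; rewrite internalU.
Qed.

Lemma internal_setsC : setC_closed internal_sets.
Proof. by move=> _ [A _ <-]; eexists => //; rewrite internalC. Qed.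

HB.instance Definition _ := isAlgebraOfSets.Build default_measure_display
  internal_algebra internal_sets0 internal_setsU internal_setsC.

Context {R : realType}.
Implicit Types A B : forall n, set (G n).

(** An internal set determines its components only U-almost everywhere, so some are chosen; any
    other set gets empty ones by default. *)
Definition internal_components (X : set internal_algebra) :
    forall n, set (G n) :=
  if pselect (exists A, internal A = X) is left h then sval (cid h)
  else fun=> set0.

Lemma internal_componentsK A :
  internal (internal_components (internal A)) = internal A.
Proof.
rewrite /internal_components; case: pselect => [h|[]]; last by exists A.
exact: svalP (cid h).
Qed.

Definition density A (n : nat) : R := mean (\1_(A n) : G n -> R).

Lemma density01 A n : 0 <= density A n <= 1.
Proof.
apply: mean01 => [|x]; first exact: fin_carrier_nonempty.
by rewrite indicE; case: (_ \in _); rewrite ?lexx ler01.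
Qed.

Definition loeb (X : set internal_algebra) : \bar R :=
  (ulim U (density (internal_components X)))%:E.

Lemma loeb_internal A : loeb (internal A) = (ulim U (density A))%:E.
Proof.
congr EFin; apply: (@eq_ulim R U UU); first exact: density01.
have := internal_inj (internal_componentsK A).
by apply: filterS => n /= AE; rewrite /density AE.
Qed.

Lemma loeb0 : loeb set0 = 0%E.
Proof.
rewrite -internal0 loeb_internal; congr EFin; apply: ulim_eq.
apply: cvg_near_cst; apply: nearW => n; rewrite /density indic0.
exact: mean_cst (fin_carrier_nonempty _) _.
Qed.

Lemma loeb_ge0 X : (0 <= loeb X)%E.
Proof. 
rewrite lee_fin.
by have /andP[] := @ulim01 R U UU _ (density01 (internal_components X)).
Qed.

Lemma loebT : loeb setT = 1%E.
Proof.
rewrite -[setT]setC0 -internal0 internalC loeb_internal; congr EFin.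
apply: ulim_eq; apply: cvg_near_cst; apply: nearW => n.
rewrite /density setC0 indicT; exact: mean_cst (fin_carrier_nonempty _) _.
Qed.

(** Disjoint internal sets have disjoint components U-almost everywhere, and there the densities
    add. *)
Lemma loeb_semi_additive : measure_function.semi_additive loeb.
Proof.
apply/(additive2P loeb0) => _ _ [A _ <-] [B _ <-] AB0.
rewrite internalU !loeb_internal -EFinD; congr EFin; apply: ulim_eq.
apply: cvg_trans
  (cvgD (@cvg_ulim R U UU _ (density01 A)) (@cvg_ulim R U UU _ (density01 B))).
apply: near_eq_cvg.
have : U [set n | A n `&` B n = set0].
  by apply: internal_inj; rewrite internal0 -internalI.
apply: filterS => n /= ABn; rewrite -[LHS]meanD; congr mean.
apply/funext => x; rewrite !indicE in_setU; case: (boolP (x \in A n)) => /= xA.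
  by rewrite memNset ?addr0// => xB; rewrite -[False]/(set0 x) -ABn inE in xA *.
by rewrite add0r.
Qed.

HB.instance Definition _ := isContent.Build _ internal_algebra R loeb
  loeb_ge0 loeb_semi_additive.

End loeb_content.

(** * Sigma-additivity and the Caratheodory extension *)

Section loeb_measure.
Context {L : language} (G : nat -> fin_structure L).
Context (U : set_system nat) {UU : UltraFilter U}.
Hypothesis nonprincipal : forall n : nat, U <> principal_filter n.
Context (R : realType).
Local Notation T := (ultra_carrier G U).
Local Notation IA := (@internal_algebra L G U UU).
Local Notation loeb := (@loeb L G U UU R).

(** If no finite subunion sufficed, the differences of [internal B] and the [F i] would have the
    finite intersection property; saturation would give a point of the union lying in no [F i]. *)
Lemma internal_bigcup_finite (F : nat -> set IA) (B : forall n, set (G n)) :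
  (forall i, measurable (F i)) -> \bigcup_i F i = internal B ->
  exists k, \bigcup_i F i `<=` \big[setU/set0]_(i < k) F i.
Proof.
move=> mF FB; apply: contrapT => /forallNP noF.
have [A AE] : {A : nat -> forall n, set (G n) & forall i, internal (A i) = F i}.
  apply: (@choice _ _ (fun i A => internal A = F i)) => i.
  by have [A _ <-] := mF i; exists A.
have [k|X XA] := @internal_saturation _ _ _ _ nonprincipal
    (fun i n => B n `\` A i n).
  have /existsNP[X /not_implyP[FX XF]] := noF k.+1.
  exists X => i ik; rewrite -[internal _]/(internal (fun n => B n `&` ~` A i n)).
  rewrite -internalI -internalC AE -FB; split=> // FiX; apply: XF.
  by rewrite -bigcup_mkord; exists i.
have XAB i : (internal B `&` ~` F i) X.
  by rewrite -AE internalC internalI; exact: XA.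
have [+ _] := XAB 0%N; rewrite -FB => -[i _ FiX].
by have [_ /(_ FiX)] := XAB i.
Qed.

(** The partial unions reach the whole union at a finite stage, after which the partial sums are
    constant. *)
Lemma loeb_semi_sigma_additive : semi_sigma_additive loeb.
Proof.
move=> F mF tF mUF; have [B _ BE] := mUF.
have [k Fk] := internal_bigcup_finite mF (esym BE).
apply: cvg_near_cst; near=> n.
have kn : (k <= n)%N by near: n; exists k.
rewrite big_mkord -measure_semi_additive//; last exact: bigsetU_measurable.
congr (loeb _); apply/seteqP; split.
  by rewrite -bigcup_mkord; by move=> X [i _ FX]; exists i.
by apply: (subset_trans Fk); apply: subset_bigsetU.
Unshelve. all: by end_near. Qed.

HB.instance Definition _ := Content_isMeasure.Build _ IA R loeb
  loeb_semi_sigma_additive.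

Definition loeb_measure :
    {measure set (g_sigma_algebraType (@internal_sets L G U UU)) -> \bar R} :=
  measure_extension loeb.

Lemma loeb_measureE (A : forall n, set (G n)) :
  loeb_measure (internal A) = (ulim U (density A))%:E.
Proof.
rewrite -loeb_internal; apply: measurable_mu_extE.
by exists A.
Qed.

Lemma loeb_measureT : loeb_measure setT = 1%E.
Proof.
by rewrite -(@loebT L G U UU R); apply: measurable_mu_extE; exact: measurableT.
Qed.

End loeb_measure.

(** * Integrals of ultralimits of functions *)

Section loeb_integral.
Context {L : language} (G : nat -> fin_structure L).
Context (U : set_system nat) {UU : UltraFilter U}.
Hypothesis nonprincipal : forall n : nat, U <> principal_filter n.
Context (R : realType).
Local Notation M := (g_sigma_algebraType (@internal_sets L G U UU)).
Local Notation nu := (loeb_measure G nonprincipal R).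

Lemma internal_measurable (A : forall n, set (G n)) :
  measurable (internal A : set M).
Proof. by apply: sub_sigma_algebra; exists A. Qed.

Variable h : forall n, G n -> R.
Arguments h : clear implicits.
Hypothesis h01 : forall n x, 0 <= h n x <= 1.
Arguments h01 {n} x.

Definition ulim_fun (X : M) : R := ulim U (fun n => h n (repr X n)).

Let cvg_h (X : M) : h n (repr X n) @[n --> U] --> ulim_fun X.
Proof. by apply: cvg_ulim => n; exact: h01. Qed.

Lemma measurable_ulim_fun : measurable_fun [set: M] ulim_fun.
Proof.
apply: (measurability _ (RGenOInfty.measurableE R)) => /= _ [_ [a ->] <-].
(* A limit exceeds [a] iff for some rational [q > a] the values exceed [q] U-almost everywhere. With
   [a < ratr q] inside the components, all other [q] contribute the empty set. *)
rewrite setTI [X in measurable X](_ : _ = \bigcup_(q : rat)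
    internal (fun n => [set x | a < ratr q /\ ratr q < h n x])); last first.
  apply/seteqP; split=> X; rewrite /= in_itv/= andbT.
    move=> /rat_in_itvoo[q]; rewrite in_itv/= => /andP[aq qX]; exists q => //=.
    have : \forall n \near U, ratr q < h n (repr X n).
      exact: cvgr_gt (@cvg_h X) _ qX.
    by apply: filterS => n /= ?; split.
  move=> [q _ /= Xq].
  have [n [aq _]] := filter_ex Xq; apply: (lt_le_trans aq).
  apply: limr_ge; first exact: cvgP (@cvg_h X).
  by apply: filterS Xq => m /= [_ /ltW].
by apply: bigcupT_measurable_rat => q; exact: internal_measurable.
Qed.

Lemma ulim_fun01 (X : M) : 0 <= ulim_fun X <= 1.
Proof. by apply: (@ulim01 R U UU) => n; exact: h01. Qed.

(** The cut of [h] at height (j+1)/k, multiplied out to avoid division. *)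
Let level (k j : nat) : set M :=
  internal (fun n => [set x | j.+1%:R <= k%:R * h n x]).

(** [U] decides each level, hence finitely many of them on a single set of [U]. *)
Let indic_levelE (k : nat) (X : M) :
  \forall n \near U, forall j : 'I_k,
    \1_(level k j) X = (j.+1%:R <= k%:R * h n (repr X n))%R%:R :> R.
Proof.
apply: filter_forall => j; rewrite indicE.
have [Xj|nXj] := pselect (level k j X).
  by rewrite mem_set//; apply: (filterS _ Xj) => n /= ->.
rewrite memNset//; apply: filterS (ultra_dichotomy nXj) => n /= /negP/negbTE ->.
by [].
Qed.

Let cvg_kh (k : nat) (X : M) :
  k%:R * h n (repr X n) @[n --> U] --> k%:R * ulim_fun X.
Proof. by apply: cvgMl_tmp; exact: cvg_h. Qed.

Let sum_level_le (k : nat) (X : M) :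
  \sum_(j < k) \1_(level k j) X <= k%:R * ulim_fun X.
Proof.
rewrite -(cvg_lim _ (@cvg_kh k X))//.
apply: limr_ge; first exact: cvgP (@cvg_kh k X).
apply: filterS (indic_levelE k X) => n lX.
rewrite (eq_bigr _ (fun j _ => lX j)); apply: sum_layers_le.
by rewrite mulr_ge0//; case/andP: (h01 (repr X n)).
Qed.

Let le_sum_level (k : nat) (X : M) :
  k%:R * ulim_fun X <= \sum_(j < k) \1_(level k j) X + 1.
Proof.
rewrite -(cvg_lim _ (@cvg_kh k X))//.
apply: limr_le; first exact: cvgP (@cvg_kh k X).
apply: filterS (indic_levelE k X) => n lX.
rewrite (eq_bigr _ (fun j _ => lX j)); apply: le_sum_layers.
by rewrite ler_piMr//; case/andP: (h01 (repr X n)).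
Qed.

(** Multiplied by [k], the integral and the limit [l] of the means both lie between the total
    measure of the first [k] levels and that total plus 1. So they differ by at most 1/k for every
    positive [k]. *)
Lemma integral_ulim_fun :
  (\int[nu]_X (ulim_fun X)%:E = (ulim U (fun n => mean (h n)))%:E)%E.
Proof.
pose l := ulim U (fun n => mean (h n)).
have lcvg : mean (h n) @[n --> U] --> l.
  by apply: cvg_ulim => n; apply: mean01; [exact: fin_carrier_nonempty|exact: h01].
have klcvg k : k%:R * mean (h n) @[n --> U] --> k%:R * l.
  exact: cvgMl_tmp lcvg.
(* By [loeb_measureE], this is the measure of [level k j]. *)
pose D (k j : nat) : R :=
  ulim U (density (fun n => [set x : G n | j.+1%:R <= k%:R * h n x])).
have mlevel k j : measurable (level k j) by exact: internal_measurable.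
have nuS k : (\int[nu]_X (\sum_(j < k) \1_(level k j) X)%:E =
    (\sum_(j < k) D k j)%:E)%E.
  under eq_integral do rewrite -sumEFin.
  rewrite ge0_integral_sum//; last first.
    by move=> j; apply/measurable_EFinP; exact: measurable_indic.
  rewrite -sumEFin; apply: eq_bigr => j _.
  by rewrite integral_indic// setIT loeb_measureE.
pose S (k n : nat) : R :=
  \sum_(j < k) density (fun n => [set x : G n | j.+1%:R <= k%:R * h n x]) n.
have cvgS k : S k n @[n --> U] --> \sum_(j < k) D k j.
  apply: (cvg_big (op := +%R) (x0 := 0)) => [|j _]; first exact: add_continuous.
  exact: (@cvg_ulim R U UU _ (density01 _)).
have SE k n :
    S k n = mean (fun x => \sum_(j < k) (j.+1%:R <= k%:R * h n x)%R%:R).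
  rewrite mean_sum; apply: eq_bigr => j _; congr mean; apply/funext => x.
  rewrite indicE; congr (_%:R); congr nat_of_bool.
  by apply/idP/idP; rewrite inE.
(* The layer bounds hold pointwise on each [G n]; they are averaged, then passed to the limit. *)
have lS k : \sum_(j < k) D k j <= k%:R * l <= \sum_(j < k) D k j + 1.
  apply/andP; split.
    apply: (ler_cvg_to (cvgS k) (klcvg k)); apply: nearW => n.
    rewrite SE -meanZ; apply: le_mean; first exact: fin_carrier_nonempty.
    move=> x; apply: sum_layers_le.
    by rewrite mulr_ge0//; case/andP: (h01 x).
  have cvgS1 : S k n + 1 @[n --> U] --> \sum_(j < k) D k j + 1.
    by apply: cvgD (cvgS k) _; exact: cvg_cst.
  apply: (ler_cvg_to (klcvg k) cvgS1); apply: nearW => n /=.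
  rewrite SE -[X in _ + X](mean_cst (fin_carrier_nonempty (G n)) 1).
  rewrite -meanD -meanZ; apply: le_mean; first exact: fin_carrier_nonempty.
  move=> x; apply: le_sum_layers.
  by rewrite ler_piMr//; case/andP: (h01 x).
have mu_ : measurable_fun [set: M] (EFin \o ulim_fun).
  by apply/measurable_EFinP; exact: measurable_ulim_fun.
have mS k : measurable_fun [set: M] (fun X => \sum_(j < k) \1_(level k j) X : R).
  by apply: measurable_sum => j; exact: measurable_indic.
have u0 X : 0 <= ulim_fun X by case/andP: (ulim_fun01 X).
have S0 k X : 0 <= \sum_(j < k) \1_(level k j) X :> R by rewrite sumr_ge0.
have iS k : ((\sum_(j < k) D k j)%:E <= k%:R%:E * \int[nu]_X (ulim_fun X)%:E
    <= (\sum_(j < k) D k j + 1)%:E)%E.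
  rewrite -ge0_integralZl_EFin//; last by move=> X _; rewrite lee_fin.
  (* As the total mass is 1, the summand 1 is the integral of the constant 1, and the bounds compare
     integrands pointwise. *)
  rewrite EFinD -nuS -[1%:E](@loeb_measureT L G U UU nonprincipal R).
  rewrite -[X in (_ + X)%E]mul1e -integral_cst//.
  rewrite -ge0_integralD//; last 2 first.
  - by move=> X _; rewrite lee_fin.
  - by apply/measurable_EFinP; exact: mS.
  apply/andP; split; apply: ge0_le_integral => //.
  - by move=> X _; rewrite lee_fin.
  - by apply/measurable_EFinP; exact: mS.
  - by apply: measurable_funeM.
  - by move=> X _; rewrite -EFinM lee_fin; exact: sum_level_le.
  - by move=> X _; rewrite -EFinM lee_fin mulr_ge0.
  - by apply: measurable_funeM.
  - by apply: emeasurable_funD => //; apply/measurable_EFinP; exact: mS.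
  - by move=> X _; rewrite -EFinM -EFinD lee_fin; exact: le_sum_level.
move: (iS); set I := (\int[nu]_X _)%E => iS'.
(* The case [k = 1] already encloses the integral between two reals. *)
have : I \is a fin_num.
  have := iS' 1%N; rewrite mul1e fin_numE.
  by case: (I) => //= /andP[].
case: I iS' => // r iS' _; congr EFin; apply/eqP; rewrite -subr_eq0 -normr_le0.
apply/ler_addgt0Pr => e e0; rewrite add0r.
(* This [k] exceeds 1/e, so an error of 1 in the scaled quantities is at most [k * e]. *)
pose k := (Num.truncn e^-1).+1.
have ke : 1 <= k%:R * e.
  by rewrite -ler_pdivrMr// div1r ltW// truncnS_gt.
have k0 : (0 : R) < k%:R by rewrite ltr0n.
rewrite -(ler_pM2l k0); apply: le_trans ke.
have := iS' k; rewrite -EFinM !lee_fin => /andP[].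
have /andP[] := lS k.
set s := \sum_(j < k) _; move=> Sl lS1 Sr rS1.
rewrite -[X in X * _](gtr0_norm k0) -normrM mulrBr ler_norml.
by apply/andP; split; rewrite -?/l; lra.
Qed.

End loeb_integral.

(** * Los's theorem *)

Section los.
Context {L : language} {G : nat -> fin_structure L}.
Context {U : set_system nat} {UU : UltraFilter U}.
Local Notation T := (ultra_carrier G U).

Definition component (p : nat) (v : 'I_p -> T) (n : nat) : 'I_p -> G n :=
  fun i => repr (v i) n.

Lemma component_extend (p : nat) (X : T) (v : 'I_p -> T) (n : nat) :
  component (extend X v) n = extend (repr X n) (component v n).
Proof. by apply/funext => i; rewrite /component /extend; case: unlift. Qed.

(** Witnesses chosen at each [n], with a default point where none exists, assemble into one class.
    [P] is arbitrary so as to cover a formula and its negation. *)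
Lemma ultra_ex (p : nat) (P : forall n, ('I_p.+1 -> G n) -> Prop)
    (v : 'I_p -> T) :
  (exists X : T, U [set n | P n (component (extend X v) n)]) <->
  U [set n | exists x, P n (extend x (component v n))].
Proof.
split=> [[X]|Uex].
  by apply: filterS => n /=; rewrite component_extend; exists (repr X n).
have wit n : {x : G n | (exists y, P n (extend y (component v n))) ->
    P n (extend x (component v n))}.
  apply: cid; have [[y Py]|no] :=
    pselect (exists y, P n (extend y (component v n))); first by exists y.
  by exists (fin_point (G n)).
exists (ultra_class G U (fun n => sval (wit n))).
apply: filterS2 Uex (repr_ultra_class (fun n => sval (wit n))) => n /= ex E.
by rewrite component_extend E; exact: (svalP (wit n)).
Qed.

Lemma los (p : nat) (phi : formula L p) (v : 'I_p -> T) :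
  sat (M := ultraproduct G U) phi v <->
  U [set n | sat (M := G n) phi (component v n)].
Proof.
have ultraN (P : nat -> Prop) : (~ U [set n | P n]) <-> U [set n | ~ P n].
  split=> [/ultra_dichotomy//|UnP UP].
  by have [n []] := filter_ex (filterI UnP UP).
elim: phi v => {p} [p|p i j|p r t|p phi IH|p phi IHp psi IHq|p phi IHp psi IHq
    |p phi IHp psi IHq|p phi IH|p phi IH] v /=.
- by split=> // /filter_ex[].
- by rewrite -{1}(reprK (v i)) -{1}(reprK (v j)); exact: ultra_classP.
- rewrite /ultra_interp/=.
  have E n : map_tuple (fun X : T => repr X n) (map_tuple v t) =
      map_tuple (component v n) t.
    by apply: eq_from_tnth => i; rewrite !tnth_map.
  by split; apply: filterS => n /=; rewrite E.
- by rewrite IH; exact: ultraN.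
- rewrite IHp IHq; split=> [[]|Uand]; first exact: filterS2.
  by split; apply: filterS Uand => n [].
- rewrite IHp IHq; split=> [[]|Uor]; [| |].
  + by apply: filterS => n; left.
  + by apply: filterS => n; right.
  apply: contrapT => /not_orP[/ultraN Up /ultraN Uq].
  by have [n [[]]] := filter_ex (filterI Uor (filterI Up Uq)); move=> /=; tauto.
- rewrite IHp IHq; split=> [pq|Uimp Up]; last first.
    by apply: filterS2 Uimp Up => n /=; exact.
  apply: contrapT => /ultraN Unimp.
  have /pq Uq : U [set n | sat (M := G n) phi (component v n)].
    by apply: filterS Unimp => n /= /not_implyP[].
  by have [n []] := filter_ex (filterI Unimp Uq); move=> /=; tauto.
(* The universal quantifier is read as a negated existential, so that [ultra_ex] applies again. *)
- transitivity (~ exists X,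
      U [set n | ~ sat (M := G n) phi (component (extend X v) n)]).
    split=> [all [X /ultraN nX]|nex X]; first exact/nX/IH.
    by apply/IH; apply: contrapT => /ultraN nX; apply: nex; exists X.
  rewrite (ultra_ex (fun n w => ~ sat (M := G n) phi w)) ultraN.
  split; apply: filterS => n /=.
    by move=> nex x; apply: contrapT => nx; apply: nex; exists x.
  by move=> all [x]; exact.
- rewrite -(ultra_ex (fun n w => sat (M := G n) phi w)).
  by split=> -[X /IH sX]; exists X.
Qed.

End los.

(** * Iterated integrals as ultralimits of iterated means *)

Section iterated.
Context {L : language} (G : nat -> fin_structure L).
Context (U : set_system nat) {UU : UltraFilter U}.
Hypothesis nonprincipal : forall n : nat, U <> principal_filter n.
Context (R : realType) (p : nat).
Local Notation M := (g_sigma_algebraType (@internal_sets L G U UU)).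
Local Notation nu := (loeb_measure G nonprincipal R).

Lemma component_update (v : 'I_p -> M) (i : 'I_p) (X : M) (n : nat) :
  component (update v i X) n = fupdate (component v n) i (repr X n).
Proof. by apply/funext => j; rewrite /component /update /fupdate; case: eqP. Qed.

Definition ulim_valuation (f : forall n, ('I_p -> G n) -> R)
    (v : 'I_p -> M) : \bar R :=
  (ulim U (fun n => f n (component v n)))%:E.

(** Induction on [s] for all [f] at once: integrating [i] turns the ultralimit of [f] into that of
    [mean_var i] of [f], again with values in [0, 1]. *)
Lemma iterated_ulim_fun (s : seq 'I_p) (f : forall n, ('I_p -> G n) -> R) :
  (forall n v, 0 <= f n v <= 1) ->
  iterated_measurable nu s (ulim_valuation f) /\
  iterated_integral nu s (ulim_valuation f) =
    ulim_valuation (fun n => iterated_mean s (f n)).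
Proof.
elim: s f => //= i s IH f f01.
pose h (v : 'I_p -> M) n (x : G n) := f n (fupdate (component v n) i x).
have fE v X : ulim_valuation f (update v i X) = (ulim_fun (h v) X)%:E.
  by rewrite /ulim_valuation /ulim_fun; under eq_fun do rewrite component_update.
have -> : integrate_var nu i (ulim_valuation f) =
    ulim_valuation (fun n => mean_var i (f n)).
  apply/funext => v; rewrite /integrate_var; under eq_integral do rewrite fE.
  by apply: integral_ulim_fun => n x; exact: f01.
have [|mI ->] := IH (fun n => mean_var i (f n)).
  by move=> n v; apply: mean01 => [|x]; [exact: fin_carrier_nonempty|exact: f01].
split=> //; split=> // v; under eq_fun do rewrite fE.
apply/measurable_EFinP; apply: measurable_ulim_fun => n x; exact: f01.
Qed.

Lemma iterated_formula_indic (s : seq 'I_p) (phi : formula L p) :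
  (forall i, i \in s) ->
  let one_phi := formula_indic R (M := ultraproduct G U) phi in
  iterated_measurable nu s one_phi /\
  forall v, iterated_integral nu s one_phi v =
    (lim (stone_pairing R phi (G i) @[i --> U]))%:E.
Proof.
move=> alls one_phi; pose f n (w : 'I_p -> G n) : R :=
  \1_[set w | sat (M := G n) phi w] w.
have f01 n w : 0 <= f n w <= 1.
  by rewrite /f indicE; case: (_ \in _); rewrite ?lexx ler01.
(* By [los] and [ulim_indic], the indicator is the ultralimit of the indicators on the [G n]. *)
have -> : one_phi = ulim_valuation f.
  apply/funext => v; congr EFin.
  rewrite (@ulim_indic R U UU _ (fun n => [set w | sat (M := G n) phi w])).
  rewrite indicE; congr (nat_of_bool _)%:R.
  by apply/idP/asboolP; rewrite inE => /los.
have [mI ->] := iterated_ulim_fun s f01; split=> // v.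
congr ((lim (_ @ U))%:E); apply/funext => n.
by rewrite stone_pairingE iterated_mean_all//; exact: fin_carrier_nonempty.
Qed.

End iterated.

Theorem proposition4 (R : realType) (L : language) (G : nat -> fin_structure L)
    (U : set_system nat) (UU : UltraFilter U)
    (nonprincipal : forall n : nat, U <> principal_filter n) :
  exists (S : set (set (ultra_carrier G U)))
         (nu : {measure set (g_sigma_algebraType S) -> \bar R}),
  forall (p : nat) (phi : formula L p),
    let lim_phi : \bar R := (lim (stone_pairing R phi (G i) @[i --> U]))%:E in
    let one_phi := formula_indic R (M := ultraproduct G U) phi in
    (iterated_measurable nu (enum 'I_p) one_phi /\
     forall v, iterated_integral nu (enum 'I_p) one_phi v = lim_phi) /\
    (forall sigma : 'S_p,
       let order := [seq sigma i | i <- enum 'I_p] in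
       iterated_measurable nu order one_phi /\
       forall v, lim_phi = iterated_integral nu order one_phi v).
Proof.
exists (@internal_sets L G U UU), (loeb_measure G nonprincipal R) => p phi.
split; first by apply: iterated_formula_indic => i; rewrite mem_enum.
(* As [sigma] is surjective, the permuted enumeration still contains every variable. *)
move=> sigma; have [i|mI iI] := @iterated_formula_indic L G U UU nonprincipal R p
  [seq sigma i | i <- enum 'I_p] phi.
  by rewrite -[i](permKV sigma) map_f// mem_enum.
by split=> // v; rewrite iI.
Qed.
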